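(* $\mathbb{Q}_0^{ia}$, the initial algebra among the algebras over the signature $\Sigma_{iamdz}$ that satisfy the equations $E_{iamdz}\cup\{(1+x^2+y^2)\cdot(1+x^2+y^2)^{-1}=1\}$, is (up to isomorphism) the subalgebra of the $\Sigma_{iamdz}$-reduct of $\mathbb{Q}_0^{i}$ (the inversive meadow of rational numbers) whose domain is the set of all non-negative rational numbers.
   Context: The signature $\Sigma_{iamdz}$ of inversive arithmetical meadows with zero has the constants $0,1$, the binary operators $+$ and $\cdot$, and the unary operator ${}^{-1}$ (no additive inverse). $E_{iamdz}$ is the set of equations $(x+y)+z=x+(y+z)$, $x+y=y+x$, $x+0=x$, $(x\cdot y)\cdot z=x\cdot(y\cdot z)$, $x\cdot y=y\cdot x$, $x\cdot 1=x$, $x\cdot(y+z)=x\cdot y+x\cdot z$, $(x^{-1})^{-1}=x$, $x\cdot(x\cdot x^{-1})=x$. $I(\Sigma,E)$ denotes the initial algebra (unique up to isomorphism) among the algebras over the signature $\Sigma$ that satisfy the equations $E$; thus $\mathbb{Q}_0^{ia}=I(\Sigma_{iamdz},E_{iamdz}\cup\{(1+x^2+y^2)\cdot(1+x^2+y^2)^{-1}=1\})$, the inversive arithmetical meadow of rational numbers with zero. The signature $\Sigma_{imd}$ of inversive meadows has the constants $0,1$, the binary operators $+,\cdot$, and the unary operators $-$ and ${}^{-1}$. $E_{imd}$ consists of the axioms of a commutative ring with a multiplicative identity (namely $(x+y)+z=x+(y+z)$, $x+y=y+x$, $x+0=x$, $x+(-x)=0$, $(x\cdot y)\cdot z=x\cdot(y\cdot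 z)$, $x\cdot y=y\cdot x$, $x\cdot 1=x$, $x\cdot(y+z)=x\cdot y+x\cdot z$) together with $(x^{-1})^{-1}=x$ and $x\cdot(x\cdot x^{-1})=x$. The inversive meadow of rational numbers is $\mathbb{Q}_0^{i}=I(\Sigma_{imd},E_{imd}\cup\{(1+x^2+y^2)\cdot(1+x^2+y^2)^{-1}=1\})$; by earlier known work it is (isomorphic to) the field of rational numbers expanded with the total multiplicative inverse operation satisfying $0^{-1}=0$, and its elements are identified with rational numbers in this way. Here $p^0=1$ and $p^{n+1}=p^n\cdot p$ for natural number exponents. *)

(* Defs.v *)
From Stdlib Require Import ClassicalEpsilon FunctionalExtensionality.
From Stdlib Require Import PropExtensionality ProofIrrelevance.
From Stdlib Require List.
From mathcomp Require Import all_boot all_order all_algebra.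

Set Implicit Arguments.
Unset Strict Implicit.
Unset Printing Implicit Defensive.

Import Order.TTheory GRing.Theory Num.Theory.

Declare Scope term_scope.
Delimit Scope term_scope with term.

(* One-sorted signatures whose operators have arity at most two. *)
Record signature := Signature {
  constant : Type;
  unary : Type;
  binary : Type
}.

Inductive term (S : signature) (V : Type) :=
| Var of V
| Cst of constant S
| Un of unary S & term S V
| Bin of binary S & term S V & term S V.

Arguments Var {S V} _.
Arguments Cst {S V} _.
Arguments Un {S V} _ _.
Arguments Bin {S V} _ _ _.
Bind Scope term_scope with term.

Record algebra (S : signature) := Algebra {
  carrier :> Type;
  cst_op : constant S -> carrier;
  un_op : unary S -> carrier -> carrier;
  bin_op : binary S -> carrier -> carrier -> carrier
}.

Fixpoint eval S V (A : algebra S) (v : V -> A) (t : term S V) : A :=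
  match t with
  | Var x => v x
  | Cst c => cst_op A c
  | Un f t1 => un_op f (eval v t1)
  | Bin f t1 t2 => bin_op f (eval v t1) (eval v t2)
  end.

Record equation (S : signature) := Equation {
  lhs : term S nat;
  rhs : term S nat
}.
Notation "s '≐' t" := (Equation s%term t%term) (at level 70, no associativity).

Definition satisfies S (A : algebra S) (e : equation S) : Prop :=
  forall v : nat -> A, eval v (lhs e) = eval v (rhs e).

Definition model S (E : seq (equation S)) (A : algebra S) : Prop :=
  forall e, List.In e E -> satisfies A e.

Definition homomorphism S (A B : algebra S) (h : A -> B) : Prop :=
  [/\ forall c, h (cst_op A c) = cst_op B c,
      forall f x, h (un_op f x) = un_op f (h x)
    & forall f x y, h (bin_op f x y) = bin_op f (h x) (h y)].

Definition isomorphism S (A B : algebra S) (h : A -> B) : Prop :=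
  homomorphism h /\ bijective h.

Definition isomorphic S (A B : algebra S) : Prop :=
  exists h : A -> B, isomorphism h.

(* [initial E A]: A is the initial algebra I(S, E), which is only determined
   up to isomorphism. *)
Definition initial S (E : seq (equation S)) (A : algebra S) : Prop :=
  model E A /\
  forall B : algebra S, model E B ->
    exists h : A -> B,
      homomorphism h /\ forall g : A -> B, homomorphism g -> g =1 h.

Record signature_map (S T : signature) := SignatureMap {
  cst_map : constant S -> constant T;
  un_map : unary S -> unary T;
  bin_map : binary S -> binary T
}.

Definition reduct S T (m : signature_map S T) (A : algebra T) : algebra S :=
  {| carrier := A;
     cst_op := fun c => cst_op A (cst_map m c);
     un_op := fun f => @un_op T A (un_map m f);
     bin_op := fun f => @bin_op T A (bin_map m f) |}.

Record closed_under_ops S (A : algebra S) (D : pred A) : Prop := ClosedUnderOps {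
  closed_cst : forall c, D (cst_op A c);
  closed_un : forall f x, D x -> D (un_op f x);
  closed_bin : forall f x y, D x -> D y -> D (bin_op f x y)
}.

Definition subalgebra S (A : algebra S) (D : pred A)
    (clD : closed_under_ops D) : algebra S :=
  {| carrier := {x : A | D x};
     cst_op := fun c => exist _ (cst_op A c) (closed_cst clD c);
     un_op := fun f x =>
       exist _ (un_op f (val x)) (closed_un clD f (valP x));
     bin_op := fun f x y =>
       exist _ (bin_op f (val x) (val y)) (closed_bin clD f (valP x) (valP y)) |}.

Inductive meadow_constant := Zero | One.
Inductive meadow_binary := Add | Mul.
Inductive iamdz_unary := InvA.
Inductive imd_unary := Opp | Inv.

Definition meadow_signature (U : Type) : signature :=
  Signature meadow_constant U meadow_binary.

Definition sig_iamdz : signature := meadow_signature iamdz_unary.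
Definition sig_imd : signature := meadow_signature imd_unary.

Definition iamdz_in_imd : signature_map sig_iamdz sig_imd :=
  @SignatureMap sig_iamdz sig_imd id (fun _ => Inv) id.

Notation "0" := (Cst (S := meadow_signature _) Zero) : term_scope.
Notation "1" := (Cst (S := meadow_signature _) One) : term_scope.
Notation "s + t" := (Bin (S := meadow_signature _) Add s t) : term_scope.
Notation "s * t" := (Bin (S := meadow_signature _) Mul s t) : term_scope.
Notation "- t" := (Un (S := sig_imd) Opp t) : term_scope.

Fixpoint term_pow U V (t : term (meadow_signature U) V) (n : nat)
    : term (meadow_signature U) V :=
  match n with
  | 0%N => 1
  | n'.+1 => term_pow t n' * t
  end%term.
Notation "t ^ n" := (term_pow t n%N) : term_scope.

Section MeadowEquations.
(* The equations not mentioning additive inverses are common to both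
   signatures; [inv] is the symbol for multiplicative inverse. *)
Variables (U : Type) (inv : U).

Let x : term (meadow_signature U) nat := Var 0%N.
Let y : term (meadow_signature U) nat := Var 1%N.
Let z : term (meadow_signature U) nat := Var 2%N.
Let tinv (t : term (meadow_signature U) nat) :
  term (meadow_signature U) nat := Un (S := meadow_signature U) inv t.

Definition arithmetical_meadow_equations : seq (equation (meadow_signature U)) :=
  [:: (x + y) + z ≐ x + (y + z);
      x + y ≐ y + x;
      x + 0 ≐ x;
      (x * y) * z ≐ x * (y * z);
      x * y ≐ y * x;
      x * 1 ≐ x;
      x * (y + z) ≐ x * y + x * z;
      tinv (tinv x) ≐ x;
      x * (x * tinv x) ≐ x].

Definition two_squares_equation : equation (meadow_signature U) :=
  (1 + x ^ 2 + y ^ 2) * tinv (1 + x ^ 2 + y ^ 2) ≐ 1.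

End MeadowEquations.

Definition E_iamdz : seq (equation sig_iamdz) :=
  arithmetical_meadow_equations InvA.

Definition E_imd : seq (equation sig_imd) :=
  (Var 0%N + (- Var 0%N) ≐ 0) :: arithmetical_meadow_equations Inv.

Definition E_Qia : seq (equation sig_iamdz) :=
  E_iamdz ++ [:: two_squares_equation InvA].

Definition E_Qi : seq (equation sig_imd) :=
  E_imd ++ [:: two_squares_equation Inv].

(* The field of rational numbers with its inverse totalized by 0^-1 = 0, which
   is the library's convention (invr0). *)
Definition rat_meadow : algebra sig_imd :=
  @Algebra sig_imd rat
    (fun c => match c with Zero => 0 | One => 1 end)%R
    (fun f (q : rat) => match f with Opp => - q | Inv => q^-1 end)%R
    (fun f (p q : rat) => match f with Add => p + q | Mul => p * q end)%R.

Section InitialAlgebraExists.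
(* Ground terms modulo validity in all models, presented by chosen
   representatives. *)
Variables (S : signature) (E : seq (equation S)).

Definition ground := term S void.

Definition geval (A : algebra S) (t : ground) : A :=
  eval (fun x : void => match x with end) t.

Definition valid (s t : ground) : Prop :=
  forall A : algebra S, model E A -> geval A s = geval A t.

Definition repr_of (t : ground) : ground :=
  epsilon (inhabits t) (fun s => valid s t).

Lemma repr_ofP t : valid (repr_of t) t.
Proof. by apply: (epsilon_spec (inhabits t) (valid^~ t)); exists t => A _. Qed.

Lemma repr_of_eq s t : valid s t -> repr_of s = repr_of t.
Proof.
move=> st; have eqP : (fun u => valid u s) = (fun u => valid u t).
  apply: functional_extensionality => u; apply: propositional_extensionality.
  by split=> H A mA; rewrite H ?st.
rewrite /repr_of eqP; congr epsilon; exact: proof_irrelevance.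
Qed.

Lemma repr_of_idem t : repr_of (repr_of t) = repr_of t.
Proof. exact/repr_of_eq/repr_ofP. Qed.

Definition class_of (t : ground) : {s : ground | repr_of s = s} :=
  exist _ (repr_of t) (repr_of_idem t).

Definition term_algebra : algebra S :=
  {| carrier := {t : ground | repr_of t = t};
     cst_op := fun c => class_of (Cst c);
     un_op := fun f x => class_of (Un f (sval x));
     bin_op := fun f x y => class_of (Bin f (sval x) (sval y)) |}.

Lemma class_of_eq s t : valid s t -> class_of s = class_of t.
Proof. by move=> st; apply: subset_eq_compat; exact: repr_of_eq. Qed.

Lemma class_ofK (x : term_algebra) : class_of (sval x) = x.
Proof.
by case: x => t rt; exact: subset_eq_compat.
Qed.

Lemma geval_eval A (mA : model E A) V (v : V -> term_algebra) t :
  geval A (sval (eval v t)) = eval (fun x => geval A (sval (v x))) t.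
Proof.
by elim: t => [x|c|f t IHt|f t IHt u IHu] //=; rewrite repr_ofP //= -?IHt -?IHu.
Qed.

Lemma initial_exists : initial E term_algebra.
Proof.
split=> [e eE v|B mB].
  rewrite -[LHS]class_ofK -[RHS]class_ofK; apply: class_of_eq => A mA.
  by rewrite !geval_eval //; exact: mA.
exists (fun x => geval B (sval x)); split.
  by split=> [c|f x|f x y] /=; rewrite repr_ofP.
move=> g [gc gu gb]; suff H t : g (class_of t) = geval B t.
  by move=> x; rewrite -{1}(class_ofK x) H.
have un_cl f u : class_of (Un f u) = @un_op S term_algebra f (class_of u).
  apply: class_of_eq => A mA.
  by transitivity (un_op f (geval A (repr_of u))); first rewrite repr_ofP.
have bin_cl f u w :
    class_of (Bin f u w) = @bin_op S term_algebra f (class_of u) (class_of w).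
  apply: class_of_eq => A mA.
  by transitivity (bin_op f (geval A (repr_of u)) (geval A (repr_of w)));
    first rewrite !repr_ofP.
elim: t => [[]|c|f t IHt|f t IHt u IHu]; first exact: gc.
  by rewrite un_cl gu IHt.
by rewrite bin_cl gb IHt IHu.
Qed.

End InitialAlgebraExists.

(* Main.v *)
(* Pigeonhole in F_p shows that every prime divides some 1 + a^2 + b^2, so the
   two-squares equation makes every positive numeral invertible, without using
   additive inverses. In any model A of the equations, m/n |-> m * n^-1 is then
   a well-defined homomorphism from the non-negative rationals to A, and it
   extends to all rationals by p - q |-> h p - h q when A has additive inverses.
   As Q and its non-negative part have no endomorphism but the identity, these
   homomorphisms invert those given by initiality. *)
Require Import Defs.
From HB Require Import structures.
From mathcomp Require Import all_boot all_order all_algebra.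
From mathcomp Require Import boolp ring.

Set Implicit Arguments.
Unset Strict Implicit.
Unset Printing Implicit Defensive.

Import Order.TTheory GRing.Theory Num.Theory.

Local Open Scope ring_scope.

(** * Squares in finite fields *)

(** Squaring has one preimage over [0] and at most two over each other square, so
    [#|F| <= 1 + 2 * (s - 1)] with [s] the number of squares. *)
Lemma card_squares (F : finFieldType) :
  (#|F| < (#|[set x ^+ 2 | x in F]|).*2)%N.
Proof.
have sq0 : 0 \in [set x ^+ 2 | x in F].
  by apply/imsetP; exists 0; rewrite ?inE ?expr0n.
rewrite -[X in (X < _)%N]sum1_card (partition_big_imset (fun x => x ^+ 2)) /= (bigD1 0) //=.
rewrite [X in (_ + X < _)%N](_ : _ = \sum_(y in [set x ^+ 2 | x in F] | y != 0%R)
    #|[set x : F | x ^+ 2 == y]|)%N; last first.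
  apply: eq_bigr => y _; rewrite sum1dep_card.
  by apply: eq_card => x; rewrite !inE.
have -> : (\sum_(x in F | x ^+ 2 == 0%R) 1 = 1)%N.
  rewrite sum1dep_card (_ : [set x | _] = [set 0]) ?cards1 //.
  by apply/setP => x; rewrite !inE expf_eq0.
rewrite (cardsD1 0) sq0 !add1n doubleS !ltnS -muln2.
rewrite -sum_nat_const; under [X in (_ <= X)%N]eq_bigl do rewrite !inE andbC.
apply: leq_sum => y /andP[/imsetP[x _ ->] _].
apply: leq_trans (_ : #|[set x; - x]| <= 2)%N; last by rewrite cards2; case: eqP.
by apply/subset_leq_card/subsetP => z; rewrite !inE eqf_sqr.
Qed.

(** The squares and their image under [a |-> - 1 - a] each fill more than half of [F], so they
    meet. *)
Lemma finField_two_squares (F : finFieldType) :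
  exists x y : F, 1 + x ^+ 2 + y ^+ 2 = 0.
Proof.
pose A := [set x ^+ 2 | x in F]; pose B := [set - 1 - a | a in A].
have cardB : #|B| = #|A|.
  by apply: card_imset; apply: inj_comp; [exact: addrI|exact: oppr_inj].
have [AB0|[a]] := set_0Vmem (A :&: B); last first.
  rewrite inE => /andP[/imsetP[x _ ax] /imsetP[_ /imsetP[y _ ->] ay]].
  by exists x, y; rewrite -ax ay; ring.
have := max_card (mem (A :|: B)).
by rewrite cardsU AB0 cards0 subn0 cardB addnn leqNgt card_squares.
Qed.

Lemma prime_dvd_two_squares p :
  prime p -> exists x y, (p %| 1 + x ^ 2 + y ^ 2)%N.
Proof.
move=> p_pr; have [x [y xy0]] := finField_two_squares 'F_p.
exists x, y; rewrite (dvdn_pcharf (pchar_Fp p_pr)) !natrD !natrX !natr_Zp.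
exact/eqP.
Qed.

Lemma nneg_ratP (q : rat) :
  0 <= q -> exists m n, (0 < n)%N /\ q = m%:R / n%:R.
Proof.
move=> q_ge0; exists `|numq q|%N, `|denq q|%N; split.
  by rewrite absz_gt0 denq_neq0.
by rewrite !natr_absz !ger0_norm ?numq_ge0 ?denq_ge0 ?divq_num_den.
Qed.

(** * Mapping the non-negative rationals into a semiring *)

Section TwoSquaresMeadow.
Variables (S : comPzSemiRingType) (iv : S -> S).
Hypothesis ivK : involutive iv.
Hypothesis mulmulV : forall x, x * (x * iv x) = x.
Hypothesis two_squares_inv :
  forall x y, (1 + x ^+ 2 + y ^+ 2) * iv (1 + x ^+ 2 + y ^+ 2) = 1.

Lemma ivmulmul x : iv x * (iv x * x) = iv x.
Proof. by rewrite -{3}[x]ivK mulmulV. Qed.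

(** Both [x * y] and [x * iv x] equal [x * (x * y) * iv x]; hence [y] and [iv x] both equal
    [x * y * iv x]. *)
Lemma iv_unique x y : x * (x * y) = x -> y * (y * x) = y -> y = iv x.
Proof.
move=> xxy yyx.
have xyxz : x * y = x * iv x.
  transitivity (x * (x * y) * iv x); last by rewrite xxy.
  by rewrite -{1}(mulmulV x); ring.
transitivity (x * y * iv x); last by rewrite xyxz -{3}ivmulmul; ring.
by rewrite -{1}yyx [y * x]mulrC {1}xyxz; ring.
Qed.

Lemma iv0 : iv 0 = 0.
Proof. by rewrite -(@iv_unique 0 0) ?mul0r. Qed.

Lemma iv1 : iv 1 = 1.
Proof. by rewrite -(@iv_unique 1 1) ?mul1r. Qed.

Lemma ivM x y : iv (x * y) = iv x * iv y.
Proof.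
symmetry; apply: iv_unique.
  by rewrite -[RHS](congr2 *%R (mulmulV x) (mulmulV y)); ring.
by rewrite -[RHS](congr2 *%R (ivmulmul x) (ivmulmul y)); ring.
Qed.

Lemma mulfV_of_unit x y : x * y = 1 -> x * iv x = 1.
Proof.
move=> xy1; transitivity (x * (x * iv x) * y); last by rewrite mulmulV.
by rewrite -[LHS]mulr1 -xy1; ring.
Qed.

(** Strong induction, splitting off the least prime factor [p]: since [k * p = 1 + a^2 + b^2] is
    invertible, so is [p]. *)
Lemma natr_mulV n : (0 < n)%N -> n%:R * iv n%:R = 1 :> S.
Proof.
elim/ltn_ind: n => n IHn n_gt0.
have [n_gt1|] := ltnP 1 n; last first.
  by case: n n_gt0 {IHn} => [|[|]] // _ _; rewrite iv1 mulr1.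
move: (pdiv n) (pdiv_prime n_gt1) (pdiv_dvd n) => p p_pr /dvdnP[m nE].
have m_gt0 : (0 < m)%N by move: n_gt0; rewrite nE muln_gt0 => /andP[].
have [a [b /dvdnP[k abE]]] := prime_dvd_two_squares p_pr.
have pU : p%:R * iv p%:R = 1.
  apply: (@mulfV_of_unit _ (k%:R * iv (1 + a%:R ^+ 2 + b%:R ^+ 2))).
  rewrite mulrA -natrM mulnC -abE !natrD !natrX; exact: two_squares_inv.
have mU : m%:R * iv m%:R = 1.
  by apply: IHn => //; rewrite nE ltn_Pmulr ?prime_gt1.
by rewrite nE natrM ivM mulrACA mU pU mulr1.
Qed.

(** A negative [q] gets the value at [- q]; the morphism laws are claimed only on [Num.nneg]. *)
Definition of_nneg_rat (q : rat) : S := `|numq q|%:R * iv `|denq q|%:R.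

Lemma of_nneg_ratE m n :
  (0 < n)%N -> of_nneg_rat (m%:R / n%:R) = m%:R * iv n%:R.
Proof.
move=> n_gt0; rewrite /of_nneg_rat; set q := _ / _.
have n_neq0 : n%:R != 0 :> rat by rewrite pnatr_eq0 -lt0n.
have q_ge0 : 0 <= q by rewrite divr_ge0 ?ler0n.
have d_gt0 : (0 < `|denq q|)%N by rewrite absz_gt0 denq_neq0.
have mdE : (`|numq q| * n = m * `|denq q|)%N.
  apply/eqP; rewrite -(eqr_nat rat) !natrM !natr_absz.
  rewrite !ger0_norm ?ler0z ?numq_ge0 ?denq_ge0 //.
  by rewrite numqE /q; apply/eqP; field.
(* The inserted factor is [1]; [mdE] then trades [m * denq q] for [numq q * n], and [n * iv n]
   cancels. *)
transitivity (m%:R * iv n%:R * (`|denq q|%:R * iv `|denq q|%:R)).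
  transitivity (`|numq q|%:R * n%:R * iv n%:R * iv `|denq q|%:R).
    by rewrite -[_ * n%:R * _]mulrA natr_mulV // mulr1.
  by rewrite -natrM mdE natrM; ring.
by rewrite natr_mulV // mulr1.
Qed.

Lemma of_nneg_rat_nat n : of_nneg_rat n%:R = n%:R.
Proof. by rewrite -[n%:R]divr1 (@of_nneg_ratE n 1) // iv1 mulr1. Qed.

Lemma of_nneg_ratD :
  {in Num.nneg &, {morph of_nneg_rat : p q / p + q}}.
Proof.
move=> p q; rewrite !nnegrE => /nneg_ratP[m [n [n_gt0 ->]]].
move=> /nneg_ratP[k [l [l_gt0 ->]]].
rewrite addf_div ?pnatr_eq0 -?lt0n // -!natrM -natrD.
rewrite !of_nneg_ratE ?muln_gt0 ?n_gt0 // natrD !natrM ivM.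
transitivity (m%:R * iv n%:R * (l%:R * iv l%:R) +
              k%:R * iv l%:R * (n%:R * iv n%:R)); first by ring.
by rewrite !natr_mulV // !mulr1.
Qed.

Lemma of_nneg_ratM :
  {in Num.nneg &, {morph of_nneg_rat : p q / p * q}}.
Proof.
move=> p q; rewrite !nnegrE => /nneg_ratP[m [n [n_gt0 ->]]].
move=> /nneg_ratP[k [l [l_gt0 ->]]].
rewrite mulf_div -!natrM !of_nneg_ratE ?muln_gt0 ?n_gt0 // !natrM ivM; ring.
Qed.

Lemma of_nneg_ratV :
  {in Num.nneg, {morph of_nneg_rat : q / q^-1 >-> iv q}}.
Proof.
move=> q; rewrite nnegrE => /nneg_ratP[[|m] [n [n_gt0 ->]]].
  (* Zero is treated apart because [of_nneg_ratE] needs a positive denominator; the default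
     [0^-1 = 0] agrees with [iv0]. *)
  by rewrite mul0r invr0 (of_nneg_rat_nat 0) iv0.
by rewrite invf_div !of_nneg_ratE // ivM ivK mulrC.
Qed.

End TwoSquaresMeadow.

(** * Extension to all rationals in a ring *)

Section TwoSquaresRing.
Variables (S : comPzRingType) (iv : S -> S).
Hypothesis ivK : involutive iv.
Hypothesis mulmulV : forall x, x * (x * iv x) = x.
Hypothesis two_squares_inv :
  forall x y, (1 + x ^+ 2 + y ^+ 2) * iv (1 + x ^+ 2 + y ^+ 2) = 1.

Let of_nnegD := of_nneg_ratD ivK mulmulV two_squares_inv.
Let of_nnegM := of_nneg_ratM ivK mulmulV two_squares_inv.
Let of_nnegV := of_nneg_ratV ivK mulmulV two_squares_inv.
Local Notation of_nneg := (of_nneg_rat iv).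

Definition of_rat (q : rat) : S :=
  if 0 <= q then of_nneg q else - of_nneg (- q).

Lemma of_rat_nneg q : 0 <= q -> of_rat q = of_nneg q.
Proof. by rewrite /of_rat => ->. Qed.

(** Any difference of non-negative rationals computes [of_rat], so the laws below for negation, sum
    and product avoid sign cases. *)
Lemma of_rat_sub (p q : rat) :
  0 <= p -> 0 <= q -> of_rat (p - q) = of_nneg p - of_nneg q.
Proof.
move=> p_ge0 q_ge0; rewrite /of_rat; case: ifPn => [pq_ge0|].
  by rewrite -[in RHS](subrK q p) [of_nneg (_ + q)]of_nnegD ?nnegrE // addrK.
rewrite opprB -ltNge subr_lt0 => /ltW; rewrite -subr_ge0 => qp_ge0.
by rewrite -[in RHS](subrK p q) [of_nneg (_ + p)]of_nnegD ?nnegrE // opprD addrCA subrr addr0.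
Qed.

Lemma rat_subP (q : rat) : exists a b, [/\ 0 <= a, 0 <= b & q = a - b].
Proof.
have [q_ge0|/ltW q_le0] := leP 0 q; first by exists q, 0; rewrite subr0.
by exists 0, (- q); rewrite oppr_ge0 opprK add0r.
Qed.

Lemma of_ratN : {morph of_rat : q / - q}.
Proof.
by move=> q; have [a [b [a0 b0 ->]]] := rat_subP q; rewrite !(opprB, of_rat_sub).
Qed.

Lemma of_ratD : {morph of_rat : p q / p + q}.
Proof.
move=> p q; have [a [b [a0 b0 ->]]] := rat_subP p.
have [c [d [c0 d0 ->]]] := rat_subP q.
rewrite addrACA -opprD !of_rat_sub ?addr_ge0 // !of_nnegD ?nnegrE //; ring.
Qed.

Lemma of_ratM : {morph of_rat : p q / p * q}.
Proof.
move=> p q; have [a [b [a0 b0 ->]]] := rat_subP p.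
have [c [d [c0 d0 ->]]] := rat_subP q.
have -> : (a - b) * (c - d) = (a * c + b * d) - (a * d + b * c) by ring.
rewrite !of_rat_sub ?addr_ge0 ?mulr_ge0 //.
rewrite !of_nnegD ?nnegrE ?mulr_ge0 // !of_nnegM ?nnegrE //; ring.
Qed.

Lemma ivN x : iv (- x) = - iv x.
Proof.
symmetry; apply: (iv_unique ivK mulmulV).
  by rewrite -[RHS](congr1 -%R (mulmulV x)); ring.
by rewrite -[RHS](congr1 -%R (ivmulmul ivK mulmulV x)); ring.
Qed.

Lemma of_ratV : {morph of_rat : q / q^-1 >-> iv q}.
Proof.
move=> q; have [q_ge0|/ltW q_le0] := leP 0 q.
  by rewrite !of_rat_nneg ?invr_ge0 // of_nnegV.
rewrite -[q]opprK invrN [in LHS]of_ratN [in RHS]of_ratN ivN !of_rat_nneg ?invr_ge0 ?oppr_ge0 //.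
by rewrite of_nnegV // nnegrE oppr_ge0.
Qed.

End TwoSquaresRing.

(** Numerals are fixed by induction; multiplying by the denominator, which can be cancelled, reduces
    a fraction to its numerator. *)
Lemma nneg_rat_endo (g : rat -> rat) :
  g 0 = 0 -> g 1 = 1 ->
  {in Num.nneg &, {morph g : p q / p + q}} ->
  {in Num.nneg &, {morph g : p q / p * q}} ->
  {in Num.nneg, g =1 id}.
Proof.
move=> g0 g1 gD gM.
have gn n : g n%:R = n%:R.
  elim: n => [//|n IHn].
  by rewrite mulrSr gD ?nnegrE ?ler01 ?ler0n // IHn g1.
move=> q; rewrite nnegrE => /[dup] q_ge0 /nneg_ratP[m [n [n_gt0 qE]]].
have n_neq0 : n%:R != 0 :> rat by rewrite pnatr_eq0 -lt0n.
apply: (mulIf n_neq0); rewrite -{1}gn -gM ?nnegrE ?ler0n //.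
by rewrite qE divfK // gn.
Qed.

(** * Models of the equations as semirings and rings *)

(** One list serves both signatures: it is [E_Qia] for [InvA], and [E_Qi] without its first equation
    for [Inv]. *)
Definition two_squares_meadow_equations U (inv : U) :=
  arithmetical_meadow_equations inv ++ [:: two_squares_equation inv].

Lemma model_nth S (E : seq (equation S)) (A : algebra S) i e :
  model E A -> List.nth_error E i = Some e -> satisfies A e.
Proof. move=> A_model nth_e; apply: A_model; exact: (List.nth_error_In _ i nth_e). Qed.

Section ModelSemiring.
Variables (U : Type) (inv : U) (A : algebra (meadow_signature U)).
Hypothesis A_model : model (two_squares_meadow_equations inv) A.

Let zero : A := @cst_op (meadow_signature U) A Zero.
Let one : A := @cst_op (meadow_signature U) A One.
Let add : A -> A -> A := @bin_op (meadow_signature U) A Add.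
Let mul : A -> A -> A := @bin_op (meadow_signature U) A Mul.
Let iv : A -> A := @un_op (meadow_signature U) A inv.
(** Every variable from the third on takes the default [z]. *)
Let val x y z : nat -> A := nth z [:: x; y].

Fact model_addA : associative add.
Proof. move=> x y z; symmetry; exact: (model_nth (i := 0) A_model erefl (val x y z)). Qed.

Fact model_addC : commutative add.
Proof. by move=> x y; exact: (model_nth (i := 1) A_model erefl (val x y y)). Qed.

Fact model_add0 : left_id zero add.
Proof.
by move=> x; rewrite model_addC; exact: (model_nth (i := 2) A_model erefl (val x x x)).
Qed.

Fact model_mulA : associative mul.
Proof. move=> x y z; symmetry; exact: (model_nth (i := 3) A_model erefl (val x y z)). Qed.

Fact model_mulC : commutative mul.
Proof. by move=> x y; exact: (model_nth (i := 4) A_model erefl (val x y y)). Qed.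

Fact model_mul1 : left_id one mul.
Proof.
by move=> x; rewrite model_mulC; exact: (model_nth (i := 5) A_model erefl (val x x x)).
Qed.

Fact model_mulDl : left_distributive mul add.
Proof.
move=> x y z; rewrite -!(model_mulC z).
exact: (model_nth (i := 6) A_model erefl (val z x y)).
Qed.

Fact model_ivK : involutive iv.
Proof. by move=> x; exact: (model_nth (i := 7) A_model erefl (val x x x)). Qed.

Fact model_mulmulV x : mul x (mul x (iv x)) = x.
Proof. exact: (model_nth (i := 8) A_model erefl (val x x x)). Qed.

Fact model_two_squares x y :
  let t := add (add one (mul x x)) (mul y y) in mul t (iv t) = one.
Proof.
(* [term_pow] starts from [1], so a square evaluates to [1 * x * x]; this removes the leading
   factor. *)
have mul1 z : @bin_op (meadow_signature U) A Mul (cst_op A One) z = z.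
  exact: model_mul1.
have := model_nth (i := 9) A_model erefl (val x y y).
by rewrite /= !mul1.
Qed.

(* 0 * x = 0 is not among the equations. Putting z = 0 * x, the inverse v of
   1 + z^2 satisfies v = 1, since 0 = 0 * ((1 + z^2) * v) = z^2 * v. Hence
   z^2 = 0 * x^2 = 0 for every x, and then 0 = 0 * (x + 1)^2 = 0 * x. *)
Fact model_mul0 : left_zero zero mul.
Proof.
have addx0 x : add x zero = x by rewrite model_addC model_add0.
have mulDr x y z : mul x (add y z) = add (mul x y) (mul x z).
  by rewrite !(model_mulC x) model_mulDl.
have mulx1 x : mul x one = x by rewrite model_mulC model_mul1.
have mul00 : mul zero zero = zero.
  rewrite -[LHS]model_add0 -{1}(mulx1 zero) -mulDr addx0 mulx1 //.
have sq0 x : mul zero (mul x x) = zero.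
  set w := mul zero (mul x x).
  have w0 : mul zero w = w by rewrite /w model_mulA mul00.
  have wE : w = mul (mul zero x) (mul zero x).
    rewrite /w -{1}mul00 -!model_mulA; congr mul.
    by rewrite model_mulC -model_mulA (model_mulC x zero).
  have := model_two_squares (mul zero x) zero; rewrite -wE mul00 addx0 /=.
  set v := iv _ => v1.
  have wv0 : mul w v = zero.
    have := congr1 (mul zero) v1.
    by rewrite mulx1 model_mulA mulDr mulx1 w0 model_add0.
  have v_one : v = one by move: v1; rewrite model_mulDl model_mul1 wv0 addx0.
  by rewrite -wv0 v_one mulx1.
move=> x; rewrite -[RHS](sq0 (add x one)) !mulDr !model_mulDl !model_mul1 mulx1.
rewrite !mulDr sq0 mulx1 addx0 model_add0.
by rewrite -model_mulDl addx0.
Qed.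

(* Mentioning [A_model] makes the semiring instances inferable from the type. *)
Definition model_semiring : Type := let _ := A_model in carrier A.

HB.instance Definition _ := gen_eqMixin model_semiring.
HB.instance Definition _ := gen_choiceMixin model_semiring.
HB.instance Definition _ :=
  GRing.isNmodule.Build model_semiring model_addA model_addC model_add0.
HB.instance Definition _ :=
  GRing.Nmodule_isComPzSemiRing.Build model_semiring
    model_mulA model_mulC model_mul1 model_mulDl model_mul0.

End ModelSemiring.

Lemma E_Qi_two_squares (A : algebra sig_imd) :
  model E_Qi A -> model (two_squares_meadow_equations Inv) A.
Proof. by move=> A_model e e_in; apply: A_model; right. Qed.

Section ModelRing.
Variables (A : algebra sig_imd) (A_model : model E_Qi A).

Definition model_ring : Type := model_semiring (E_Qi_two_squares A_model).

HB.instance Definition _ := GRing.ComPzSemiRing.on model_ring.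

Let opp : model_ring -> model_ring := @un_op sig_imd A Opp.

Fact model_addN : left_inverse 0 opp +%R.
Proof.
move=> x; rewrite addrC.
exact: (model_nth (i := 0) A_model erefl (fun _ => x)).
Qed.

HB.instance Definition _ :=
  GRing.Nmodule_isZmodule.Build model_ring model_addN.

End ModelRing.

(** * Homomorphisms from the rationals into models *)

Lemma rat_meadow_to_model (A : algebra sig_imd) :
  model E_Qi A -> exists h : rat -> A, @homomorphism sig_imd rat_meadow A h.
Proof.
move=> A_model; pose S : comPzRingType := model_ring A_model.
pose iv : S -> S := @un_op sig_imd A Inv.
have ivK : involutive iv := model_ivK (E_Qi_two_squares A_model).
have mulmulV : forall x, x * (x * iv x) = x :=
  model_mulmulV (E_Qi_two_squares A_model).
have sqV : forall x y, (1 + x ^+ 2 + y ^+ 2) * iv (1 + x ^+ 2 + y ^+ 2) = 1 :=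
  model_two_squares (E_Qi_two_squares A_model).
exists (of_rat iv); split=> [[]|[] q|[] p q].
- rewrite of_rat_nneg //; exact: (of_nneg_rat_nat ivK mulmulV sqV 0).
- rewrite of_rat_nneg //; exact: (of_nneg_rat_nat ivK mulmulV sqV 1).
- exact: (of_ratN ivK mulmulV sqV).
- exact: (of_ratV ivK mulmulV sqV).
- exact: (of_ratD ivK mulmulV sqV).
- exact: (of_ratM ivK mulmulV sqV).
Qed.

(** Laws relative to [Num.nneg] allow [h] to be composed with [to_rat] on the non-negative part of
    any [Qi]. *)
Lemma nneg_rat_to_model (A : algebra sig_iamdz) :
  model E_Qia A -> exists h : rat -> A,
  [/\ forall c, h (cst_op rat_meadow c) = cst_op A c,
      {in Num.nneg, forall q, h q^-1 = @un_op sig_iamdz A InvA (h q)}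
    & forall f : meadow_binary, {in Num.nneg &, forall p q,
        h (@bin_op sig_imd rat_meadow f p q) = @bin_op sig_iamdz A f (h p) (h q)}].
Proof.
move=> A_model; pose S : comPzSemiRingType := model_semiring A_model.
pose iv : S -> S := @un_op sig_iamdz A InvA.
have ivK : involutive iv := model_ivK A_model.
have mulmulV : forall x, x * (x * iv x) = x := model_mulmulV A_model.
have sqV : forall x y, (1 + x ^+ 2 + y ^+ 2) * iv (1 + x ^+ 2 + y ^+ 2) = 1 :=
  model_two_squares A_model.
exists (of_nneg_rat iv); split=> [[]||[]].
- exact: (of_nneg_rat_nat ivK mulmulV sqV 0).
- exact: (of_nneg_rat_nat ivK mulmulV sqV 1).
- exact: (of_nneg_ratV ivK mulmulV sqV).
- exact: (of_nneg_ratD ivK mulmulV sqV).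
- exact: (of_nneg_ratM ivK mulmulV sqV).
Qed.

(** * Models obtained from the rationals, reducts and subalgebras *)

Lemma rat_meadow_model : model E_Qi rat_meadow.
Proof.
apply/List.Forall_forall; (do !apply: List.Forall_cons) => // v /=; try by ring.
- exact: invrK.
- have [->|x_neq0] := eqVneq (v 0%N) 0; first by rewrite mul0r.
  by rewrite mulfV // mulr1.
- rewrite !mul1r mulfV // lt0r_neq0 //.
  by rewrite -!expr2 -addrA ltr_pwDl ?addr_ge0 ?sqr_ge0.
Qed.

Lemma reduct_model (A : algebra sig_imd) :
  model E_Qi A -> model E_Qia (reduct iamdz_in_imd A).
Proof.
move=> A_model; apply/List.Forall_forall.
(do !apply: List.Forall_cons) => // v.
(* Position 0 of [E_Qi] holds the additive-inverse equation, so all positions shift by one. *)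
- exact: (model_nth (i := 1) A_model erefl v).
- exact: (model_nth (i := 2) A_model erefl v).
- exact: (model_nth (i := 3) A_model erefl v).
- exact: (model_nth (i := 4) A_model erefl v).
- exact: (model_nth (i := 5) A_model erefl v).
- exact: (model_nth (i := 6) A_model erefl v).
- exact: (model_nth (i := 7) A_model erefl v).
- exact: (model_nth (i := 8) A_model erefl v).
- exact: (model_nth (i := 9) A_model erefl v).
- exact: (model_nth (i := 10) A_model erefl v).
Qed.

Lemma eval_subalgebra S (A : algebra S) (D : pred A)
    (clD : closed_under_ops D) V (v : V -> subalgebra clD) (t : term S V) :
  val (eval v t) = eval (fun x => val (v x)) t.
Proof. by elim: t => [x|c|f t IHt|f t IHt u IHu] //=; rewrite ?IHt ?IHu. Qed.

Lemma subalgebra_model S (E : seq (equation S)) (A : algebra S) (D : pred A)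
    (clD : closed_under_ops D) :
  model E A -> model E (subalgebra clD).
Proof.
move=> A_model e e_in v; apply: val_inj.
by rewrite !eval_subalgebra; apply: A_model.
Qed.

Lemma comp_homomorphism S (A B C : algebra S) (f : B -> C) (g : A -> B) :
  homomorphism f -> homomorphism g -> homomorphism (f \o g).
Proof.
move=> [fc fu fb] [gc gu gb]; split=> [c|u x|b x y] /=.
- by rewrite gc fc.
- by rewrite gu fu.
- by rewrite gb fb.
Qed.

(** Both [f] and [id] must be the unique endomorphism given by initiality. *)
Lemma initial_endo S (E : seq (equation S)) (A : algebra S) (f : A -> A) :
  initial E A -> homomorphism f -> f =1 id.
Proof.
move=> [A_model /(_ A A_model)[h [_ h_uniq]]] f_hom x.
by rewrite (h_uniq f f_hom) -(h_uniq id).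
Qed.

(** * Identification of the initial algebras *)

Theorem theorem3 (Qia : algebra sig_iamdz) (Qi : algebra sig_imd)
    (Qia_initial : initial E_Qia Qia) (Qi_initial : initial E_Qi Qi) :
  exists to_rat : Qi -> rat,
    @isomorphism sig_imd Qi rat_meadow to_rat /\
    exists nonneg_closed : @closed_under_ops sig_iamdz (reduct iamdz_in_imd Qi)
                             (fun q : Qi => (0 <= to_rat q)%R),
      isomorphic Qia (subalgebra nonneg_closed).
Proof.
have [to_rat [to_rat_hom _]] := Qi_initial.2 _ rat_meadow_model.
have [of_rat of_rat_hom] := rat_meadow_to_model Qi_initial.1.
(* Initiality of [rat_meadow] is not yet available, so rigidity of the non-negative rationals is
   used, with negation covering the rest. *)
have of_ratK : cancel of_rat to_rat.
  have [gc gu gb] := comp_homomorphism to_rat_hom of_rat_hom.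
  have g_nneg := nneg_rat_endo (gc Zero) (gc One) (in2W (gb Add)) (in2W (gb Mul)).
  move=> q; have [q_ge0|/ltW q_le0] := leP 0 q; first exact: g_nneg.
  apply: oppr_inj; rewrite -[LHS](gu Opp q); apply: g_nneg.
  by rewrite nnegrE oppr_ge0.
have to_ratK : cancel to_rat of_rat.
  by move=> x; apply: (initial_endo Qi_initial (comp_homomorphism of_rat_hom to_rat_hom)).
exists to_rat; split; first by split=> //; exists of_rat.
have [tc tu tb] := to_rat_hom.
have closed : @closed_under_ops sig_iamdz (reduct iamdz_in_imd Qi)
    (fun q : Qi => 0 <= to_rat q).
  split=> [c|f x x0|f x y x0 y0] /=.
  - by rewrite tc; case: c.
  - by rewrite (tu Inv) /= invr_ge0.
  - by rewrite tb; case: f; rewrite /= ?addr_ge0 ?mulr_ge0.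
exists closed; pose C := subalgebra closed.
have [f [f_hom _]] := Qia_initial.2 C (subalgebra_model (clD := closed) (reduct_model Qi_initial.1)).
have [h [hc hu hb]] := nneg_rat_to_model Qia_initial.1.
(* The candidate inverse of [f] reads an element of [C] as a non-negative rational and sends it into
   [Qia]. *)
pose k (x : C) : Qia := h (to_rat (val x)).
have k_hom : homomorphism k.
  split=> [c|[] [x x0]|b [x x0] [y y0]]; rewrite /k /=.
  - by rewrite tc hc.
  - by rewrite (tu Inv) hu.
  - by rewrite tb hb.
exists f; split=> //; exists k => [x|x].
  exact: (initial_endo Qia_initial (comp_homomorphism k_hom f_hom)).
have [fc _ fb] := f_hom.
(* Seen through the injective [to_rat], [f \o k] becomes [g], which rigidity makes the identity on
   non-negative rationals. *)
pose g q := to_rat (val (f (h q))).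
apply: val_inj; apply: (can_inj to_ratK).
apply: (@nneg_rat_endo g) => [||p q p0 q0|p q p0 q0|]; last exact: (valP x).
- by rewrite /g (hc Zero) fc /= tc.
- by rewrite /g (hc One) fc /= tc.
- by rewrite /g (hb Add) // fb /= tb.
- by rewrite /g (hb Mul) // fb /= tb.
Qed.
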